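(* Let $X$ be a simplicial complex with finite vertex set $S$, and let $\{U_\alpha\}_{\alpha\in S}$ be a simple cover of $X$. Then $X$ and the nerve of $\{U_\alpha\}_{\alpha\in S}$ have the same combinatorial structure; that is, for every nonempty $\theta\subset S$, the vertices in $\theta$ span a simplex of $X$ if and only if $\bigcap_{\alpha\in\theta}U_\alpha\neq\emptyset$.
   Context: A simplicial complex $X$ is identified with its geometric realization when one speaks of subsets and topology. For a vertex $\alpha$ of $X$, $\operatorname{star}(\alpha)$ is the interior in $X$ of the union of all closed simplices of $X$ having $\alpha$ as a vertex. A simple cover of $X$ is an open cover $\{U_\alpha\}_{\alpha\in S}$ of $X$, indexed by the vertex set $S$ of $X$, such that $\operatorname{cl}(U_\alpha)\subset\operatorname{star}(\alpha)$ for all $\alpha\in S$, where $\operatorname{cl}$ denotes closure. The sets $U_\alpha$ need not be connected, convex or acyclic. The nerve of $\{U_\alpha\}_{\alpha\in S}$ is the simplicial complex whose vertices are the nonempty members of the family and whose simplices are the finite nonempty subfamilies with nonempty intersection.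
   Formalization: star(α) is taken as the open star (union of relative interiors of the simplices having α as a vertex), not the interior of the closed star; with the latter the claim fails: X a single edge {a,b}, U_a = X, U_b = ∅. *)

(* Defs.v *)
(* MathComp and MathComp-Analysis. *)
From HB Require Import structures.
From mathcomp Require Import all_boot all_order all_algebra.
From mathcomp Require Import all_classical all_reals all_analysis.

Set Implicit Arguments.
Unset Strict Implicit.
Unset Printing Implicit Defensive.

Import Order.TTheory GRing.Theory Num.Theory.
Import numFieldNormedType.Exports.

Local Open Scope classical_set_scope.
Local Open Scope ring_scope.

(* Every element of [S] is a vertex: [S] is exactly the vertex set. *)
Record simplicial_complex (S : finType) := SimplicialComplex {
  simplices :> {set {set S}};
  simplex_neq0 : forall s, s \in simplices -> s != finset.set0;
  simplex_vertex : forall a : S, [set a]%SET \in simplices;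
  simplex_face : forall s t : {set S},
    s \in simplices -> t \subset s -> t != finset.set0 -> t \in simplices }.

(* Barycentric coordinates: a point is a function [S -> R].  As [S] is finite,
   the topology induced by the product topology of [R^S] is the usual (weak)
   topology of the realization. *)
Definition realization (R : realType) (S : finType) (X : simplicial_complex S)
  : set {ptws S -> R} :=
  [set x | [/\ forall a, 0 <= x a,
               \sum_a x a = 1 &
               [set a | x a != 0]%SET \in X]].

(* The points of the realization, with the library's topology on the subtype
   [set_type]: [open] and [closure] below are relative to the complex. *)
Definition points (R : realType) (S : finType) (X : simplicial_complex S)
  : topologicalType := set_type (@realization R S X).

(* The vertices at which the barycentric coordinate of [x] is nonzero, i.e. the
   unique simplex having [x] in its relative interior. *)
Definition carrier (R : realType) (S : finType) (X : simplicial_complex S)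
  (x : points R X) : {set S} := [set a | set_val x a != 0]%SET.

Definition open_simplex (R : realType) (S : finType)
  (X : simplicial_complex S) (s : {set S}) : set (points R X) :=
  [set x | carrier x = s].

(* The open star: the interiors of the simplices having [a] as a vertex.  The
   topological interior of the union of these closed simplices can be strictly
   larger: when [X] is a single edge, it is all of [X] at both endpoints. *)
Definition star (R : realType) (S : finType) (X : simplicial_complex S)
  (a : S) : set (points R X) :=
  \bigcup_(s in [set s : {set S} | s \in X /\ a \in s]) open_simplex s.

Record simple_cover (R : realType) (S : finType) (X : simplicial_complex S)
  (U : S -> set (points R X)) : Prop := SimpleCover {
  simple_cover_open : forall a, open (U a);
  simple_cover_total : \bigcup_a U a = setT;
  simple_cover_star : forall a, closure (U a) `<=` star a }.

(* Main.v *)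
(* If a point lies in all [U a] with [a] in [theta], its carrier contains [theta], so [theta]
   is a face of a simplex.  Conversely, let [theta] be a simplex and [e] a Lebesgue number of
   the cover on it.  Label a point [v] by some [a] such that [U a] contains the ball of
   radius [e] about [v]; as [U a] is contained in the star of [a], this is a Sperner
   labelling.  In an iterated barycentric subdivision of mesh less than [e] a simplex
   carrying all labels of [theta] exists by Sperner's lemma, and each of its vertices lies in
   [U a] for all [a] in [theta].  Sperner's lemma itself needs no incidence geometry:
   subdivision commutes with the boundary modulo 2, and counting the simplices whose labels
   enumerate [theta] reduces to the same count on one facet of [theta]. *)
Require Import Defs.
From HB Require Import structures.
From mathcomp Require Import all_boot all_order all_algebra.
From mathcomp Require Import all_classical all_reals all_analysis.

Set Implicit Arguments.
Unset Strict Implicit.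
Unset Printing Implicit Defensive.

Import Order.TTheory GRing.Theory Num.Theory.
Import numFieldNormedType.Exports.

Local Open Scope classical_set_scope.

(** * Ordered simplices and their subdivision modulo 2 *)

Section Subdivision.
Variable T : Type.
Implicit Types (s t u : seq T) (f : seq T -> bool).

(* An ordered simplex is the sequence of its vertices; the empty one is the boundary of a
   point (augmented chains). *)
Fixpoint facets s : seq (seq T) :=
  if s is x :: s' then s' :: [seq x :: t | t <- facets s'] else [::].

Lemma big_facets_cons x s f :
  \big[addb/false]_(t <- facets (x :: s)) f t =
  f s (+) \big[addb/false]_(t <- facets s) f (x :: t).
Proof. by rewrite /= big_cons big_map. Qed.

(** Faces of [x :: s] that omit [x] arise twice and cancel; those that keep [x] cancel by
    induction. *)
Lemma big_facets_facets s f :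
  \big[addb/false]_(t <- facets s) \big[addb/false]_(u <- facets t) f u = false.
Proof.
elim: s f => [|x s IHs] f; first by rewrite big_nil.
rewrite big_facets_cons (eq_bigr _ (fun t _ => big_facets_cons x t f)).
by rewrite big_split /= IHs addbF addbb.
Qed.

Variable c : seq T -> T.

(* [c s] plays the role of an interior point of the simplex [s]: the subdivided boundary
   is coned from it.  For the combinatorics it is arbitrary. *)
Fixpoint subdiv_rec n s : seq (seq T) :=
  if n is n'.+1 then [seq c s :: u | t <- facets s, u <- subdiv_rec n' t]
  else [:: [::]].

Definition subdiv s := subdiv_rec (size s) s.

Fixpoint iter_subdiv k s : seq (seq T) :=
  if k is k'.+1 then [seq u | t <- iter_subdiv k' s, u <- subdiv t] else [:: s].

End Subdivision.

Lemma size_facets (T : eqType) (s t : seq T) :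
  t \in facets s -> (size t).+1 = size s.
Proof.
elim: s t => [|x s IHs] //= t; rewrite inE => /predU1P[-> //|].
by case/mapP=> u us -> /=; rewrite (IHs u).
Qed.

Lemma mem_facets (T : eqType) (s t : seq T) :
  t \in facets s -> {subset t <= s}.
Proof.
elim: s t => [|x s IHs] //= t; rewrite inE => /predU1P[-> y|].
  by rewrite inE orbC => ->.
case/mapP=> u us -> y; rewrite !inE => /predU1P[->|/(IHs _ us) ->].
  by rewrite eqxx.
by rewrite orbT.
Qed.

Lemma uniq_facets (T : eqType) (s t : seq T) : t \in facets s -> uniq s -> uniq t.
Proof.
elim: s t => [|x s IHs] //= t; rewrite inE => /predU1P[-> /andP[] //|].
case/mapP=> u us -> /andP[xs us'] /=; rewrite (IHs u) // andbT.
by apply: contra xs; apply: mem_facets.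
Qed.

Lemma facets_map (T U : Type) (g : T -> U) s :
  facets (map g s) = map (map g) (facets s).
Proof. by elim: s => //= x s ->; rewrite -!map_comp. Qed.

Section SubdivisionEq.
Variables (T : eqType) (c : seq T -> T).
Implicit Types (s t u : seq T) (f : seq T -> bool).

(** A facet is one vertex shorter, so the counter [size s] in [subdiv] is exact at every level. *)
Lemma subdivE s : s != [::] ->
  subdiv c s = [seq c s :: u | t <- facets s, u <- subdiv c t].
Proof.
case: s => // x s _; rewrite {1}/subdiv.
transitivity [seq c (x :: s) :: u | t <- facets (x :: s), u <- subdiv_rec c (size s) t] => //.
by congr flatten; apply/eq_in_map => t /size_facets [st]; rewrite /subdiv st.
Qed.

(* Subdivision is a chain map modulo 2, stated by testing chains against an arbitrary [f]. *)
Lemma facets_subdiv s f :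
  \big[addb/false]_(u <- subdiv c s) \big[addb/false]_(t <- facets u) f t =
  \big[addb/false]_(t <- facets s) \big[addb/false]_(u <- subdiv c t) f u.
Proof.
elim: {s}(size s) {-2}s (leqnn (size s)) f => [|n IHn] s.
  by case: s => // _ f; rewrite !big_nil /subdiv /= big_seq1 big_nil.
have [->_ f|s0 ssz f] := eqVneq s [::].
  by rewrite !big_nil /subdiv /= big_seq1 big_nil.
rewrite subdivE // !big_allpairs_dep.
under eq_bigr => t _ do
  rewrite (eq_bigr _ (fun u _ => big_facets_cons (c s) u f)) big_split /=.
(* The first sum is the claim. In the second, induction turns the boundary of the subdivided
   boundary into the subdivided double boundary, which vanishes. *)
rewrite big_split /= [X in _ (+) X]big_seq.
under [X in _ (+) X]eq_bigr => t ts.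
  rewrite IHn; last by rewrite -ltnS (size_facets ts).
  over.
by rewrite -big_seq big_facets_facets addbF.
Qed.

Lemma facets_iter_subdiv k s f :
  \big[addb/false]_(u <- iter_subdiv c k s) \big[addb/false]_(t <- facets u) f t =
  \big[addb/false]_(t <- facets s) \big[addb/false]_(u <- iter_subdiv c k t) f u.
Proof.
elim: k f => [|k IHk] f /=.
  by rewrite big_seq1; under [RHS]eq_bigr do rewrite big_seq1.
rewrite big_allpairs_dep; under eq_bigr do rewrite facets_subdiv.
by rewrite IHk; under [RHS]eq_bigr do rewrite big_allpairs_dep.
Qed.

Lemma iter_subdiv_nil k : iter_subdiv c k [::] = [:: [::]].
Proof. by elim: k => //= k ->. Qed.

Lemma size_subdiv s u : u \in subdiv c s -> size u = size s.
Proof.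
elim: {s}(size s) {-2}s (leqnn (size s)) u => [|n IHn] s.
  by case: s => // _ u; rewrite inE => /eqP->.
have [->_ u|s0 ssz u] := eqVneq s [::]; first by rewrite inE => /eqP->.
rewrite subdivE // => /allpairsPdep[t [v [ts vt ->]]] /=.
by rewrite (IHn t) ?(size_facets ts) // -ltnS (size_facets ts).
Qed.

Lemma size_iter_subdiv k s u :
  u \in iter_subdiv c k s -> size u = size s.
Proof.
elim: k u => [|k IHk] u /=; first by rewrite inE => /eqP->.
by case/allpairsPdep => t [v [/IHk <- vt ->]]; apply: size_subdiv vt.
Qed.

End SubdivisionEq.

(* Mod-2 count of the facets of [w] that enumerate [B]: if [w] has one letter more than [B] and
   repeats a letter, the two copies give equal contributions. *)
Lemma big_facets_perm (S : eqType) (w B : seq S) : uniq B ->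
  \big[addb/false]_(t <- facets w) perm_eq t B =
  [&& uniq w, all (mem w) B & size w == (size B).+1].
Proof.
elim: w B => [|x w IHw] B uB; first by rewrite big_nil andbF.
rewrite big_facets_cons /= eqSS.
have pwB : perm_eq w B = [&& uniq w, all (mem w) B & size w == size B].
  apply/idP/and3P => [wB|[uw /allP Bw /eqP sw]].
    rewrite (perm_uniq wB) (perm_size wB); split => //.
    by apply/allP => y; rewrite /= (perm_mem wB).
  rewrite perm_sym; apply: uniq_perm => //.
  by apply: (uniq_min_size uB Bw _).2; rewrite sw.
(* If [x] is not in [B], only the facet [w] can enumerate [B]. Otherwise the facets that keep [x]
   are counted by induction with [rem x B]. *)
have [xB|xB] := boolP (x \in B); last first.
  rewrite big1 ?addbF => [|t _]; last first.
    by apply/negbTE/negP => /perm_mem/(_ x); rewrite (negbTE xB) mem_head.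
  rewrite pwB.
  have -> : all (mem (x :: w)) B = all (mem w) B.
    by apply: eq_in_all => y yB; rewrite !inE; case: eqP yB xB => // -> ->.
  case: (all _ _) / allP => Bw; rewrite ?andbF //=.
  case: eqP => sw; rewrite ?andbF // !andbT.
  case uw: (uniq w); rewrite ?andbF // andbT.
  suff -> : w =i B by rewrite xB.
  move=> y; have := (uniq_min_size uB Bw _).2; rewrite sw => -> //.
have pB := perm_to_rem xB.
have uR : uniq (rem x B) by rewrite rem_uniq.
have sB : size B = (size (rem x B)).+1 by rewrite (perm_size pB).
have xR : x \notin rem x B by rewrite mem_rem_uniq // !inE eqxx.
under eq_bigr => t _ do rewrite (permPr pB) perm_cons.
rewrite IHw // pwB !(perm_all _ pB) /= mem_head /= sB.
have -> : all (mem (x :: w)) (rem x B) = all (mem w) (rem x B).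
  by apply: eq_in_all => y yR; rewrite !inE; case: eqP yR xR => // -> ->.
by case: (uniq w); case: (x \in w); case: (all _ _); case: (_ == _).
Qed.

(** * Sperner's lemma by parity *)

Section Sperner.
Variables (T S : eqType) (c : seq T -> T) (V : S -> T) (l : T -> S) (k : nat).

(** Sperner's condition is assumed on all faces at once, so that it passes to the facet opposite the
    first vertex. *)
Lemma sperner_parity (A : seq S) : uniq A ->
  (forall B, {subset B <= A} -> uniq B ->
     forall u x, u \in iter_subdiv c k (map V B) -> x \in u -> l x \in B) ->
  \big[addb/false]_(u <- iter_subdiv c k (map V A)) perm_eq (map l u) A.
Proof.
elim: A => [|a A IHA] uA lA; first by rewrite iter_subdiv_nil big_seq1.
have /andP[aA uA'] := uA.
rewrite big_seq.
(* All labels lie in [a :: A], so a simplex whose facets enumerate [A] an odd number of times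
   carries every label once. *)
have E u : u \in iter_subdiv c k (map V (a :: A)) ->
    perm_eq (map l u) (a :: A) = \big[addb/false]_(t <- facets u) perm_eq (map l t) A.
  move=> uk; rewrite -(big_map _ xpredT (fun t => perm_eq t A)) -facets_map.
  rewrite big_facets_perm //.
  have lu x : x \in map l u -> x \in a :: A.
    by case/mapP => y yu ->; apply: lA yu.
  apply/idP/and3P => [p|[ul /allP Al /eqP sl]].
    rewrite (perm_uniq p) (perm_size p); split => //.
    by apply/allP => y yA; rewrite /= (perm_mem p) inE yA orbT.
  apply: uniq_perm => //.
  by apply: (uniq_min_size ul lu _).2; rewrite sl.
(* Being a chain map, subdivision moves the count to the facets of the original simplex. *)
rewrite (eq_bigr _ E) -big_seq facets_iter_subdiv facets_map big_map /= big_cons.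
rewrite IHA //; last first.
  by move=> B BA; apply: lA => y /BA; rewrite inE orbC => ->.
(* A facet containing [a] misses some label of [A], so it contributes nothing. *)
rewrite big_map big_seq big1 // => t tA.
rewrite big_seq big1 // => u ut.
apply/negbTE/negP => p.
have fa : a :: t \in facets (a :: A) by rewrite /= inE map_f ?orbT.
have ta := mem_facets fa.
have ut' := uniq_facets fa uA.
have : {subset A <= t}.
  move=> y yA; have : y \in map l u by rewrite (perm_mem p).
  case/mapP => x xu E'; have := lA _ ta ut' u x ut xu.
  by rewrite -E' inE; case: eqP yA aA => // -> ->.
by move=> /(uniq_leq_size uA'); rewrite -(size_facets tA) ltnn.
Qed.

End Sperner.

Local Open Scope ring_scope.

(** Closure of [P] under [c] stands in for convexity; it serves for coordinate intervals and, when
    iterated, for faces. *)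
Lemma subdiv_closed (T : eqType) (c : seq T -> T) (P : T -> Prop) s u :
  (forall t, t != [::] -> (forall x, x \in t -> P x) -> P (c t)) ->
  (forall x, x \in s -> P x) -> u \in subdiv c s -> forall x, x \in u -> P x.
Proof.
move=> cP; elim: {s}(size s) {-2}s (leqnn (size s)) u => [|n IHn] s.
  by case: s => // _ u _; rewrite inE => /eqP->.
have [->_ u _|s0 ssz u sP] := eqVneq s [::]; first by rewrite inE => /eqP->.
rewrite subdivE // => /allpairsPdep[t [v [ts vt ->]]] x.
rewrite inE => /predU1P[->|xv]; first exact: cP.
apply: (IHn t) vt x xv; first by rewrite -ltnS (size_facets ts).
by move=> x /(mem_facets ts)/sP.
Qed.

Lemma iter_subdiv_closed (T : eqType) (c : seq T -> T) (P : T -> Prop) k s u :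
  (forall t, t != [::] -> (forall x, x \in t -> P x) -> P (c t)) ->
  (forall x, x \in s -> P x) -> u \in iter_subdiv c k s -> forall x, x \in u -> P x.
Proof.
move=> cP sP; elim: k u => [|k IHk] u /=; first by rewrite inE => /eqP->.
by case/allpairsPdep => t [v [ts vt ->]]; apply: subdiv_closed vt => //; apply: IHk.
Qed.

(** * Barycenters and the mesh of iterated subdivisions *)

Section Mesh.
Variables (R : realFieldType) (n : nat).
Implicit Types (s t u : seq 'rV[R]_n) (x y z : 'rV[R]_n).

Definition barycenter s := (size s)%:R^-1 *: \sum_(x <- s) x.

Lemma barycenterE s i : barycenter s 0 i = (size s)%:R^-1 * \sum_(x <- s) x 0 i.
Proof. by rewrite mxE summxE. Qed.

Lemma size_neq0 (T : eqType) (s : seq T) : s != [::] -> (size s)%:R != 0 :> R.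
Proof. by case: s => // x s _; rewrite pnatr_eq0. Qed.

Lemma sum_le_const (T : eqType) (s : seq T) (F : T -> R) (a : R) :
  (forall x : T, x \in s -> F x <= a) -> \sum_(y <- s) F y <= (size s)%:R * a.
Proof.
move=> Fa; rewrite mulr_natl -iter_addr_0 -(count_predT s) -big_const_seq.
by rewrite big_seq [leRHS]big_seq; apply: ler_sum.
Qed.

Lemma mean_const (T : eqType) (s : seq T) (a : R) : s != [::] ->
  (size s)%:R^-1 * \sum_(y <- s) a = a.
Proof.
move=> s0; rewrite big_const_seq count_predT iter_addr_0.
by rewrite -[X in _ * X]mulr_natl mulKf ?size_neq0.
Qed.

Lemma barycenter_sub s i a : s != [::] ->
  barycenter s 0 i - a = (size s)%:R^-1 * \sum_(x <- s) (x 0 i - a).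
Proof. by move=> s0; rewrite big_split /= mulrDr mean_const // barycenterE. Qed.

Lemma barycenter_coord_sum s : s != [::] ->
  (forall x, x \in s -> \sum_i x 0 i = 1) -> \sum_i barycenter s 0 i = 1.
Proof.
move=> s0 s1; under eq_bigr do rewrite barycenterE.
by rewrite -big_distrr exchange_big /= (eq_big_seq _ s1) mean_const.
Qed.

Lemma barycenter_dist s z i e : s != [::] ->
  (forall x, x \in s -> `|x 0 i - z 0 i| <= e) -> `|barycenter s 0 i - z 0 i| <= e.
Proof.
move=> s0 se; have p0 : 0 < (size s)%:R :> R by rewrite lt0r size_neq0 // ler0n.
rewrite barycenter_sub //.
rewrite normrM gtr0_norm ?invr_gt0 // mulrC ler_pdivrMr //.
apply: le_trans (ler_norm_sum _ _ _) _.
by rewrite mulrC; apply: sum_le_const.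
Qed.

(* The vertex [z] itself contributes nothing to the mean distance, whence the factor below 1. *)
Lemma barycenter_vertex_dist s z i m (D : R) : (0 < size s <= m)%N ->
  z \in s -> 0 <= D -> (forall x, x \in s -> `|x 0 i - z 0 i| <= D) ->
  `|barycenter s 0 i - z 0 i| <= (1 - m%:R^-1) * D.
Proof.
move=> /andP[s0 sm] zs D0 sD.
have p0 : 0 < (size s)%:R :> R by rewrite ltr0n.
rewrite barycenter_sub; last by case: (s) s0.
rewrite (big_rem z) //= subrr add0r normrM gtr0_norm ?invr_gt0 //.
apply: (@le_trans _ _ ((1 - (size s)%:R^-1) * D)); last first.
  apply: ler_wpM2r => //; rewrite lerD2l lerN2 lef_pV2 ?posrE ?ltr0n //.
    by rewrite ler_nat.
  exact: leq_trans s0 sm.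
have -> : 1 - (size s)%:R^-1 = (size s)%:R^-1 * (size s).-1%:R :> R.
  by rewrite -subn1 natrB // mulrBr mulr1 mulVf // gt_eqF.
rewrite -mulrA; apply: ler_wpM2l; first by rewrite invr_ge0 ltW.
apply: le_trans (ler_norm_sum _ _ _) _.
by rewrite -(size_rem zs); apply: sum_le_const => x /mem_rem; apply: sD.
Qed.

(** Distances to the cone point are bounded at the vertices of [s], then extended by convexity;
    other pairs lie in a subdivided facet. As [m] only bounds the size, the factor is the same for
    all faces. *)
Lemma subdiv_mesh s u m i (D : R) : (0 < m)%N -> (size s <= m)%N -> 0 <= D ->
  {in s &, forall x y, `|x 0 i - y 0 i| <= D} -> u \in subdiv barycenter s ->
  {in u &, forall x y, `|x 0 i - y 0 i| <= (1 - m%:R^-1) * D}.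
Proof.
move=> m0 + D0; elim: {s}(size s) {-2}s (leqnn (size s)) u => [|k IHk] s.
  by case: s => // _ u _ _; rewrite inE => /eqP->.
have [->_ u _ _|s0 ssz u sm sD] := eqVneq s [::]; first by rewrite inE => /eqP->.
rewrite subdivE // => /allpairsPdep[t [v [ts vt ->]]].
have tk : (size t <= k)%N by rewrite -ltnS (size_facets ts).
have bv y : y \in v -> `|barycenter s 0 i - y 0 i| <= (1 - m%:R^-1) * D.
  rewrite distrC; apply: (subdiv_closed
    (P := fun y => `|y 0 i - barycenter s 0 i| <= (1 - m%:R^-1) * D) _ _ vt).
    by move=> r r0 rD; apply: barycenter_dist.
  move=> x /(mem_facets ts) xs; rewrite distrC; apply: barycenter_vertex_dist => //.
    by rewrite sm andbT; case: (s) s0.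
  by move=> w ws; apply: sD.
move=> x y; rewrite !inE => /predU1P[->|xv] /predU1P[->|yv].
- rewrite subrr normr0 mulr_ge0 // subr_ge0 invf_le1 ?ltr0n // ler1n //.
- exact: bv.
- by rewrite distrC; apply: bv.
- apply: (IHk t _ v _ _ vt) => //; first by rewrite (leq_trans _ sm) // -(size_facets ts).
  by move=> a b /(mem_facets ts) + /(mem_facets ts); apply: sD.
Qed.

Lemma iter_subdiv_mesh k s u m i (D : R) :
  (0 < m)%N -> (size s <= m)%N -> 0 <= D ->
  {in s &, forall x y, `|x 0 i - y 0 i| <= D} -> u \in iter_subdiv barycenter k s ->
  {in u &, forall x y, `|x 0 i - y 0 i| <= (1 - m%:R^-1) ^+ k * D}.
Proof.
move=> m0 sm D0 sD; elim: k u => [|k IHk] u /=.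
  by rewrite inE => /eqP->; rewrite mul1r.
case/allpairsPdep => t [v [ts vt ->]]; rewrite exprS -mulrA.
apply: subdiv_mesh vt => //; first by rewrite (size_iter_subdiv ts).
  by rewrite mulr_ge0 // exprn_ge0 // subr_ge0 invf_le1 ?ltr0n // ler1n.
exact: IHk.
Qed.

End Mesh.

(** * Lebesgue number of an open cover of a compact set *)

Lemma lebesgue_number (R : realType) (M : pseudoMetricType R) (I : Type)
    (K : set M) (W : I -> set M) :
  compact K -> (forall i, open (W i)) -> K `<=` \bigcup_i W i ->
  exists2 e : R, 0 < e & forall x, K x -> exists i, ball x e `<=` W i.
Proof.
move=> /compact_near_coveringP cK oW KW.
(* Near covering, with radii tending to 0 from the right as parameters, makes the locally sufficient
   radii uniform on [K]. *)
have := cK R (0^'+) (fun e x => exists i, ball x e `<=` W i) _.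
case => [x Kx|e0 /= e0_gt0 He].
  have [i _ Wx] := KW x Kx.
  have /nbhs_ballP[e /= e_gt0 He] : nbhs x (W i) by exact: open_nbhs_nbhs.
  have e2 : 0 < e / 2 by rewrite divr_gt0.
  exists (ball x (e / 2), [set r | r < e / 2]) => /=.
    split; first exact: nbhsx_ballx.
    exact: nbhs_right_lt.
  move=> [y r] /= [xy re]; exists i => z yz; apply: He.
  by rewrite (splitr e); apply: ball_triangle xy _; apply: le_ball yz; apply: ltW.
exists (e0 / 2); first by rewrite divr_gt0.
move=> x Kx; apply: (He (e0 / 2) _ _ x Kx); last by rewrite divr_gt0.
by rewrite /= sub0r normrN gtr0_norm ?divr_gt0 // ltr_pdivrMr // ltr_pMr // ltr1n.
Qed.

(** * Faces of the standard simplex in row vectors *)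

Lemma coord_sum_continuous (R : realType) n (r : seq 'I_n) :
  continuous (fun v : 'rV[R]_n => \sum_(i <- r) v 0 i).
Proof.
elim: r => [|i r IHr].
  have -> : (fun v : 'rV[R]_n => \sum_(i <- [::]) v 0 i) = fun=> 0.
    by apply/funext => v; rewrite big_nil.
  exact: cst_continuous.
have -> : (fun v : 'rV[R]_n => \sum_(j <- i :: r) v 0 j) =
    fun v => v 0 i + \sum_(j <- r) v 0 j.
  by apply/funext => v; rewrite big_cons.
by move=> v; exact: (cvgD (@coord_continuous R _ _ 0 i v) (IHr v)).
Qed.

Section Face.
Variables (R : realType) (S : finType).
Implicit Types (v : 'rV[R]_#|S|) (B : {set S}).

(* Row vectors stand for barycentric coordinates because they carry the sup metric needed
   for the Lebesgue number. *)
Definition point_of v : {ptws S -> R} := fun a => v 0 (enum_rank a).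

Lemma point_of_continuous : continuous point_of.
Proof.
move=> v; apply/cvg_sup; first exact/fmap_filter/nbhs_filter.
move=> a A [_ [[W oW <-] Wv] WA].
apply: (filterS (P := point_of @^-1` (proj a @^-1` W))) => [x /WA //|].
by apply: (@coord_continuous R _ _ 0 (enum_rank a) v W); exact: open_nbhs_nbhs.
Qed.

Definition face B : set 'rV[R]_#|S| :=
  [set v : 'rV[R]_#|S| | [/\ forall i, 0 <= v 0 i, \sum_i v 0 i = 1 &
              forall a, a \notin B -> point_of v a = 0]].

Lemma face_compact B : compact (face B).
Proof.
have cube : compact [set v : 'rV[R]_#|S| | forall i, `[0, 1]%classic (v ord0 i)].
  exact: (rV_compact (fun=> @segment_compact R 0 1)).
apply: (subclosed_compact _ cube).
- have -> : face B = (\bigcap_i [set v : 'rV[R]_#|S| | 0 <= v 0 i]) `&`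
     [set v : 'rV[R]_#|S| | \sum_i v 0 i = 1] `&`
     (\bigcap_(a in [set a | a \notin B]) [set v : 'rV[R]_#|S| | v 0 (enum_rank a) = 0]).
    apply/seteqP; split => v /=.
      by case=> v0 v1 vB; split; [split => // i _|move=> a /=]; [exact: v0|exact: vB].
    by case=> -[v0 v1] vB; split => // i; exact: v0.
  apply: closedI; first apply: closedI.
  + apply: closed_bigI => i _.
    apply: (@preimage_closed _ _ (fun v : 'rV[R]_#|S| => v 0 i) [set r | 0 <= r]).
      by move=> v _; apply: coord_continuous.
    exact: closed_ge.
  + apply: (@preimage_closed _ _ (fun v : 'rV[R]_#|S| => \sum_i v 0 i) [set 1]).
      move=> v _; apply: coord_sum_continuous.
    exact: closed_eq.
  + apply: closed_bigI => a _.
    apply: (@preimage_closed _ _ (fun v : 'rV[R]_#|S| => v 0 (enum_rank a)) [set 0]).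
      by move=> v _; apply: coord_continuous.
    exact: closed_eq.
- move=> v [v0 v1 _] i /=; rewrite in_itv /= v0 -v1 (bigD1 i) //= lerDl.
  exact: sumr_ge0.
Qed.

Lemma face_barycenter B s : s != [::] ->
  (forall v, v \in s -> face B v) -> face B (barycenter s).
Proof.
move=> s0 sB; split.
- move=> i; rewrite barycenterE mulr_ge0 ?invr_ge0 ?ler0n //.
  by rewrite big_seq sumr_ge0 // => v /sB[].
- by apply: barycenter_coord_sum => // v /sB[].
- move=> a aB; rewrite /point_of barycenterE big_seq big1 ?mulr0 // => v /sB[_ _].
  exact.
Qed.

Definition vertex (a : S) : 'rV[R]_#|S| := delta_mx 0 (enum_rank a).

Lemma vertexE a i : vertex a 0 i = (i == enum_rank a)%:R.
Proof. by rewrite mxE eqxx. Qed.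

Lemma face_sub (A B : {set S}) : A \subset B -> face A `<=` face B.
Proof.
move=> /fintype.subsetP AB v [v0 v1 vA]; split => // a aB; apply: vA.
by apply: contra aB; apply: AB.
Qed.

Lemma face_vertex B a : a \in B -> face B (vertex a).
Proof.
move=> aB; split.
- by move=> i; rewrite vertexE ler0n.
- rewrite (bigD1 (enum_rank a)) //= vertexE eqxx big1 ?addr0 // => i /negbTE ia.
  by rewrite vertexE ia.
- move=> b bB; rewrite /point_of vertexE (inj_eq enum_rank_inj).
  by case: eqP bB aB => // -> /negbTE->.
Qed.

(** The support of [v] lies in [B] and is nonempty since the coordinates sum to 1, hence it is a
    simplex of [X]. *)
Lemma face_point (X : simplicial_complex S) B v : B \in simplices X -> face B v ->
  exists x : points R X, set_val x = point_of v.
Proof.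
move=> BX [v0 v1 vB].
suff rv : point_of v \in @realization R S X by exists (SigSub rv : points R X).
apply/mem_set.
have s1 : \sum_a point_of v a = 1.
  by rewrite -v1 [RHS](reindex enum_rank) //; apply: onW_bij; apply: enum_rank_bij.
split => //; first by move=> a; apply: v0.
apply: (simplex_face BX).
  by apply/fintype.subsetP => a; rewrite inE; apply: contra_neqT; apply: vB.
apply/eqP => E; have := oner_neq0 R; rewrite -s1 big1 ?eqxx // => a _.
by apply/eqP; apply: contraT => va; have := finset.in_set0 a; rewrite -E inE va.
Qed.

End Face.

Theorem theorem7 (R : realType) (S : finType) (X : simplicial_complex S)
    (U : S -> set (points R X)) (hU : simple_cover U)
    (theta : {set S}) (htheta : theta != finset.set0) :
  theta \in simplices X <->
  \bigcap_(a in [set a | a \in theta]) U a !=set0.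
Proof.
have [Uo Ut Us] := hU.
have starE a (x : points R X) : U a x -> set_val x a != 0.
  move=> /(@subset_closure _ (U a))/Us[s [_ as_] xs].
  by move: as_; rewrite -xs inE.
split; last first.
  case=> x xU; have [_ _ cX] := set_valP x.
  apply: simplex_face cX _ htheta.
  by apply/fintype.subsetP => a at_; rewrite inE; apply: starE; apply: xU.
move=> tX.
(* Ambient open sets that trace the cover on [X] can be pulled back to row vectors. *)
have /choice[W WP] : forall a, exists W : set {ptws S -> R},
    open W /\ U a = set_val @^-1` W.
  by move=> a; case: (Uo a) => W oW WU; exists W.
have label v : face theta v -> exists a, W a (point_of v).
  move=> /(face_point tX)[x <-]; have : [set: points R X] x by [].
  by rewrite -Ut => -[a _]; rewrite (WP a).2; exists a.
(* Sperner's condition: the coordinate of [v] at its label is nonzero. *)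
have label_mem v (B : {set S}) a :
    B \subset theta -> face B v -> W a (point_of v) -> a \in B.
  move=> Bt vB; have [x xv] := face_point tX (face_sub Bt vB).
  rewrite -xv => Wx; have /starE : U a x by rewrite (WP a).2.
  by rewrite xv; apply: contraNT => aB; case: vB => _ _ ->.
have /set0Pn[a0 a0t] := htheta.
have [e e0 eW] : exists2 e : R, 0 < e & forall v, face theta v ->
     exists a, ball v e `<=` @point_of R S @^-1` (W a).
  apply: lebesgue_number; first exact: face_compact.
    move=> a; apply: open_comp; last exact: (WP a).1.
    by move=> v _; apply: point_of_continuous.
  by move=> v /label[a av]; exists a.
have /choice[l lP] : forall v, exists a,
    face theta v -> ball v e `<=` @point_of R S @^-1` (W a).
  move=> v; have [/eW[a av]|nv] := pselect (face theta v); first by exists a.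
  (* Off [face theta] the label is an arbitrary default. *)
  by exists a0.
pose r : R := 1 - #|theta|%:R^-1.
have t0 : (0 < #|theta|)%N by rewrite card_gt0.
have r0 : 0 <= r by rewrite subr_ge0 invf_le1 ?ltr0n // ler1n.
have [k rk] : exists k, r ^+ k < e.
  have r1 : `|r| < 1 by rewrite ger0_norm // ltrBlDr ltrDl invr_gt0 ltr0n.
  have /cvgr0Pnorm_lt/(_ _ e0)[k _ kP] := cvg_expr r1.
  by exists k; have := kP k (leqnn k); rewrite ger0_norm ?exprn_ge0.
pose sd (B : seq S) := iter_subdiv (@barycenter R #|S|) k (map (@vertex R S) B).
have sd_face (B : {set S}) (s : seq S) u x :
    {subset s <= B} -> u \in sd s -> x \in u -> face B x.
  move=> sB us; apply: iter_subdiv_closed us x; first exact: face_barycenter.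
  by move=> x /mapP[a /sB aB ->]; apply: face_vertex.
have [u ut ul] : exists2 u, u \in sd (enum theta) & perm_eq (map l u) (enum theta).
  apply: contrapT => nu.
  suff : \big[addb/false]_(u <- sd (enum theta)) perm_eq (map l u) (enum theta).
    by rewrite big_seq big1 // => u us; apply/negbTE/negP => ul; apply: nu; exists u.
  apply: sperner_parity => [|s st _ u x us xu]; first exact: enum_uniq.
  have st' : [set a in s]%SET \subset theta.
    by apply/fintype.subsetP => a; rewrite inE => /st; rewrite mem_enum.
  have xs : face [set a in s]%SET x.
    by apply: sd_face us xu => a; rewrite inE.
  have := label_mem x _ (l x) st' xs; rewrite inE; apply.
  by apply: (lP x (face_sub st' xs)); apply: ballxx.
have theta_face x : x \in u -> face theta x.
  by apply: sd_face ut => a; rewrite mem_enum.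
have mesh : {in u &, forall x y, ball x e y}.
  move=> x y xu yu; split => // i j; rewrite (ord1 i) /ball /= /ball_.
  (* The initial diameter is 1: coordinates of vertices are 0 or 1. *)
  apply: le_lt_trans rk; rewrite -[leRHS]mulr1.
  apply: (iter_subdiv_mesh (s := map (@vertex R S) (enum theta))) ut _ _ xu yu => //.
    by rewrite size_map -cardE.
  move=> _ _ /mapP[a _ ->] /mapP[b _ ->]; rewrite !vertexE.
  by do 2 case: (_ == _); rewrite ?subrr ?subr0 ?sub0r ?normrN ?normr0 ?normr1 ?ler01.
have lmem a : a \in theta -> exists2 x, x \in u & l x = a.
  move=> at_; have : a \in map l u by rewrite (perm_mem ul) mem_enum.
  by case/mapP => x xu ->; exists x.
have [x0 x0u _] := lmem _ a0t.
have [p px0] := face_point tX (theta_face _ x0u).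
(* Any vertex [x0] of the fully labelled simplex serves: it is within [e] of the vertex labelled
   [a]. *)
exists p => a /= /lmem[x xu <-]; rewrite (WP _).2 /= px0.
by apply: (lP x (theta_face _ xu)); apply: mesh.
Qed.
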